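(* Let $X$ be a separable Hausdorff topological space that contains a cocountable subset homeomorphic to $[0,\omega_1)$. Then $X$ admits no separately continuous mean $\mu:X^2\to X$.
   Context: Here $\omega_1$ is the first uncountable ordinal and $[0,\omega_1)$ carries the order topology. A subset $A$ of a set $X$ is called cocountable if its complement $X\setminus A$ is at most countable; a cocountable subset of $X$ is considered with the subspace topology. A mean (or mean operation) on a set $X$ is a binary operation $\mu:X\times X\to X$ such that $\mu(x,x)=x$ and $\mu(x,y)=\mu(y,x)$ for all $x,y\in X$. A function $\mu:X^2\to X$ is separately continuous if for every $a\in X$ the functions $x\mapsto\mu(a,x)$ and $x\mapsto\mu(x,a)$ from $X$ to $X$ are continuous. *)

(* Defs.v *)
From HB Require Import structures.
From mathcomp Require Import all_boot all_order.
From mathcomp Require Import all_classical topology.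
From mathcomp Require wochoice.

Set Implicit Arguments.
Unset Strict Implicit.
Unset Printing Implicit Defensive.

Import Order.TTheory.

Local Open Scope classical_set_scope.

(* [omega_1] is built by fixing a well-order of the uncountable type [set nat]
   and keeping the points that have at most countably many predecessors; see
   [omega1_is_first_uncountable] for the characterization up to isomorphism. *)

Definition wo_setnat : Type := set nat.

HB.instance Definition _ := Choice.on wo_setnat.

Fact wo_display : Order.disp_t. Proof. exact: Order.Disp tt tt. Qed.

Definition wo_le : rel wo_setnat :=
  projT1 (wochoice.well_ordering_principle wo_setnat).

Lemma wo_leP : wochoice.well_order wo_le.
Proof. exact: (projT2 (wochoice.well_ordering_principle wo_setnat)). Qed.

Lemma wo_le_wo_chain : wochoice.wo_chain wo_le predT.
Proof. by move=> A _; exact: wo_leP. Qed.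

Lemma wo_le_refl : reflexive wo_le.
Proof. by move=> x; apply: (wochoice.wo_chain_reflexive wo_le_wo_chain). Qed.

Lemma wo_le_anti : antisymmetric wo_le.
Proof.
by move=> x y; apply: (wochoice.wo_chain_antisymmetric wo_le_wo_chain).
Qed.

Lemma wo_le_total : total wo_le.
Proof. by move=> x y; apply: (wochoice.wo_chainW wo_le_wo_chain). Qed.

Lemma wo_le_trans : transitive wo_le.
Proof.
move=> y x z xy yz.
have [|w [[]]] := wo_leP (A := [pred t | [|| t == x, t == y | t == z]]).
  by exists x; rewrite inE eqxx.
rewrite inE => wE wmin _.
have wx : wo_le w x by apply: wmin; rewrite inE eqxx.
have wy : wo_le w y by apply: wmin; rewrite inE eqxx orbT.
have wz : wo_le w z by apply: wmin; rewrite inE eqxx !orbT.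
case/or3P: wE => /eqP wE; subst w => //.
- by have -> : x = y by apply: wo_le_anti; apply/andP.
- by have <- : y = z by apply: wo_le_anti; apply/andP.
Qed.

HB.instance Definition _ := Order.Le_isPOrder.Build wo_display wo_setnat
  wo_le_refl wo_le_anti wo_le_trans.
HB.instance Definition _ :=
  Order.POrder_isTotal.Build wo_display wo_setnat wo_le_total.

Definition omega1_pred : pred wo_setnat :=
  fun x => `[< countable [set y : wo_setnat | (y < x)%O] >].

(* As a von Neumann ordinal, [omega_1] is the set [0, omega_1) itself. *)
Definition omega1 : Type := {x : wo_setnat | omega1_pred x}.

Fact omega1_display : Order.disp_t. Proof. exact: Order.Disp tt tt. Qed.

HB.instance Definition _ := SubChoice.on omega1.
HB.instance Definition _ :=
  [SubChoice_isSubOrder of omega1 by <: with omega1_display].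

Definition is_first_uncountable (d : Order.disp_t) (T : orderType d) : Prop :=
  [/\ forall A : set T, A !=set0 ->
        exists2 x, A x & forall y, A y -> (x <= y)%O,
      ~ countable [set: T]
    & forall x : T, countable [set y | (y < x)%O]].

Lemma wo_min (A : set wo_setnat) :
  A !=set0 -> exists2 x, A x & forall y, A y -> (x <= y)%O.
Proof.
move=> [a Aa]; have [|w [[]]] := wo_leP (A := [pred t | `[< A t >]]).
  by exists a; apply/asboolP.
move=> /asboolP Aw wmin _; exists w => // y Ay.
by apply: wmin; apply/asboolP.
Qed.

Lemma wo_setnat_uncountable : ~ countable [set: wo_setnat].
Proof.
case/pcard_injP => f finj.
pose D : set nat := [set n | exists2 B : set nat, f B = n & ~ B n].
have injf (B C : set nat) : f B = f C -> B = C.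
  by move=> BC; apply: finj => //; rewrite inE.
have [DfD|nDfD] := pselect (D (f D)).
  by have [B /injf BD] := DfD; rewrite BD.
by apply: (nDfD); exists D.
Qed.

Lemma omega1_is_first_uncountable : is_first_uncountable omega1.
Proof.
split=> [A [a Aa]|cT|x].
- have [|_ [w Aw <-] wmin] := @wo_min (val @` A); first by exists (val a), a.
  by exists w => // y Ay; rewrite leEsub; apply: wmin; exists y.
- have cP : countable [set x | omega1_pred x].
    apply: sub_countable cT; apply: card_le_trans (card_image_le \val _).
    by apply: subset_card_le => x xP; exists (Sub x xP).
  have [allP|] := pselect (forall x, omega1_pred x).
    apply: wo_setnat_uncountable; apply: sub_countable cP.
    by apply: subset_card_le => x _; exact: allP.
  move=> /existsNP nP; have [m nPm mmin] := wo_min nP.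
  apply: nPm; apply/asboolP; apply: sub_countable cP.
  apply: subset_card_le => y /= ym; apply: contrapT => nPy.
  by have := mmin _ nPy; rewrite leNgt ym.
- have /asboolP cx := valP x; apply: sub_countable cx.
  rewrite -(card_le_eql (inj_card_eq (f := \val) (in2W val_inj))).
  by apply: subset_card_le => _ [y yx <-]; exact: yx.
Qed.

HB.instance Definition _ :=
  OrderTopological.copy omega1 (order_topology omega1).

Definition separable (X : topologicalType) : Prop :=
  exists2 D : set X, countable D & dense D.

(* For [A : set X], the coercion of [A] to a type carries the subspace topology
   (the initial topology of the inclusion), so [homeomorphic A Y] is meaningful;
   the library's [subspace A] is a different topology, on all of [X]. *)
Definition homeomorphic (X Y : topologicalType) : Prop :=
  exists (f : X -> Y) (g : Y -> X),
    [/\ continuous f, continuous g, cancel f g & cancel g f].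

Definition cocountable (X : Type) (A : set X) : Prop := countable (~` A).

Definition is_mean (X : Type) (mu : X -> X -> X) : Prop :=
  (forall x, mu x x = x) /\ (forall x y, mu x y = mu y x).

Definition separately_continuous (X : topologicalType) (mu : X -> X -> X) : Prop :=
  forall a, continuous (fun x => mu a x) /\ continuous (fun x => mu x a).

(* Main.v *)
Require Import Defs.
From mathcomp Require Import all_boot all_order.
From mathcomp Require Import all_classical topology.
From mathcomp Require Import interval.

Local Open Scope classical_set_scope.

Import Order.TTheory.

(** Write [iota : omega1 -> X] for the embedding onto the cocountable subset and
    [D] for a countable dense subset of [X].

    Two continuous maps from [omega1] to a Hausdorff space that take a common
    value at arguments beyond every ordinal agree at arbitrarily large limits,
    and countably many such pairs agree at the same limit
    ([cofinal_agreement_at_limit], an interleaving argument). Consequently a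
    continuous [f : omega1 -> X] either meets [iota] in this cofinal sense or is
    eventually constant ([cofinal_agreement_or_eventually_constant]): in the
    second case cocountability leaves only countably many values on a tail, and
    two values taken beyond every ordinal would both be taken at some limit.

    Apply the dichotomy to [f x = mu d (iota x)] for each [d] in [D]. It splits
    [D] into [D1], where [mu d] is constant on the image of a tail common to all
    of [D1], and [D2], where [mu d (iota l) = iota l] for arbitrarily large [l]
    that serve all of [D2]. Continuity of [mu] in its first argument carries
    both behaviours to the closures of [D1] and [D2], which together cover [X].
    Two points [p], [q] of the image at such ordinals [l] cannot both lie in the
    closure of [D1], as then [p = mu p p = mu p q = mu q p = mu q q = q]; nor
    both in the closure of [D2], as then [p = mu q p = mu p q = q]. But three
    such points exist, and two of them lie in the same closure. *)

(** The common values near [p] lie in every neighbourhood of [g p] and in every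
    neighbourhood of [h p], so these points cannot be separated. The arguments
    [x] and [y] may differ: at a limit ordinal it is only known that [g] and [h]
    share values below it, not that they share them at the same ordinal. *)
Lemma eq_of_common_values_nearby {T X : topologicalType} (g h : T -> X) (p : T) :
  hausdorff_space X -> {for p, continuous g} -> {for p, continuous h} ->
  (forall U, nbhs p U -> exists x y, [/\ U x, U y & g x = h y]) -> g p = h p.
Proof.
move=> hX cg ch gh; apply: hX => A B gA hB.
have [x [y [[Agx _] [_ Bhy] e]]] : exists x y,
    [/\ (g @^-1` A `&` h @^-1` B) x, (g @^-1` A `&` h @^-1` B) y & g x = h y].
  by apply: gh; apply: filterI; [exact: cg | exact: ch].
by exists (g x); split => //; rewrite e.
Qed.

Lemma eq_on_closure {T X : topologicalType} (g h : T -> X) (S : set T) :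
  hausdorff_space X -> continuous g -> continuous h ->
  (forall x, S x -> g x = h x) -> forall p, closure S p -> g p = h p.
Proof.
move=> hX cg ch gh p Sp; apply: (eq_of_common_values_nearby g h p hX (cg p) (ch p)) => U pU.
by have [x [Sx Ux]] := Sp _ pU; exists x, x; split => //; exact: gh.
Qed.

Lemma closure_dense {T : topologicalType} (S : set T) (p : T) :
  dense S -> closure S p.
Proof.
move=> dS B pB; have [|x [Bx Sx]] := dS (interior B) _ (@open_interior _ B).
  by exists p.
by exists x; split => //; exact: interior_subset.
Qed.

Lemma countable_setU {T : Type} (A B : set T) :
  countable A -> countable B -> countable (A `|` B).
Proof.
move=> cA cB; rewrite -bigcup2E.
by apply: bigcup_countable => // -[|[|n]] _ //=.
Qed.

Lemma countable_image {T U : Type} (f : T -> U) (A : set T) :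
  countable A -> countable (f @` A).
Proof. exact/sub_countable/card_image_le. Qed.

(** The initial segments closed by the elements of an unbounded countable set
    would be countably many countable sets covering [omega1]. *)
Lemma countable_bounded (S : set omega1) : countable S ->
  exists b, forall s, S s -> (s < b)%O.
Proof.
move=> cS; apply: contrapT => nb.
have [_ unc seg] := omega1_is_first_uncountable; apply: unc.
have : countable (\bigcup_(s in S) ([set y | (y < s)%O] `|` [set s])).
  apply: bigcup_countable => // s _.
  by apply: countable_setU; [exact: seg | exact: countable1].
apply: sub_countable; apply: subset_card_le => b _.
apply: contrapT => nUb; apply: nb; exists b => s Ss.
rewrite ltNge le_eqVlt; apply/negP => /orP[/eqP bs|bs];
  apply: nUb; exists s => //; [by right | by left].
Qed.

(** The ordinal [b] below [l] provides the endpoint [a] when the basic interval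
    around [l] is unbounded on the left. *)
Lemma nbhs_omega1_left (b l : omega1) (U : set omega1) : (b < l)%O -> nbhs l U ->
  exists2 a, (a < l)%O & forall x, (a < x)%O -> (x < l)%O -> U x.
Proof.
move=> bl; rewrite itv_nbhsE => -[[p q] [oi li] iU].
have xq x : (x < l)%O -> (BRight x <= q)%O.
  move: li; rewrite itv_boundlr => /andP[_ lq] xl.
  by apply: le_trans lq; rewrite bnd_simp ltW.
case: p oi li iU => [[] p|[]] oi //.
- rewrite itv_boundlr => /andP[]; rewrite bnd_simp => pl _ iU.
  exists p => // x px xl; apply: iU => /=; rewrite itv_boundlr.
  by rewrite bnd_simp px xq.
- move=> li iU; exists b => // x bx xl; apply: iU => /=.
  by rewrite itv_boundlr xq.
Qed.

Definition cofinally_agree {X : Type} (g h : omega1 -> X) : Prop :=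
  forall b, exists x y, [/\ (b < x)%O, (b < y)%O & g x = h y].

(** Interleaving: the limit [l] is the supremum of a sequence [u] such that, for
    every [i] in [D], the maps [g i] and [h i] take a common value at arguments
    strictly between any two consecutive terms. Since [D] is countable and
    countable sets are bounded, each term has a successor good for all [i]. *)
Lemma cofinal_agreement_at_limit {X : topologicalType} {I : Type} (D : set I)
    (g h : I -> omega1 -> X) : hausdorff_space X -> countable D ->
  (forall i, D i -> continuous (g i)) -> (forall i, D i -> continuous (h i)) ->
  (forall i, D i -> cofinally_agree (g i) (h i)) ->
  forall b, exists2 l, (b < l)%O & forall i, D i -> g i l = h i l.
Proof.
move=> hX cD cg ch gh b.
have next a : exists a', (a < a')%O /\ forall i, D i -> exists x y,
    [/\ (a < x < a')%O, (a < y < a')%O & g i x = h i y].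
  have /choice[p pP] i : exists p : omega1 * omega1,
      D i -> [/\ (a < p.1)%O, (a < p.2)%O & g i p.1 = h i p.2].
    have [Di|nDi] := pselect (D i); last by exists (a, a).
    by have [x [y ?]] := gh i Di a; exists (x, y).
  have [|a' a'P] := @countable_bounded
      ([set a] `|` ((fun i => (p i).1) @` D `|` (fun i => (p i).2) @` D)).
    apply: countable_setU; first exact: countable1.
    by apply: countable_setU; exact: countable_image.
  exists a'; split=> [|i Di]; first by apply: a'P; left.
  have [ax ay e] := pP i Di; exists (p i).1, (p i).2; split => //.
    by rewrite ax a'P //; right; left; exists i.
  by rewrite ay a'P //; right; right; exists i.
have [s sP] := choice next.
pose u n := iter n s b.
have [c cP] := countable_bounded (range u) (countable_image u _ (countableP _)).
have [wo _ _] := omega1_is_first_uncountable.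
have [|l ul lmin] := wo [set l | forall n, (u n < l)%O].
  by exists c => n; apply: cP; exists n.
exists l => [|i Di]; first exact: (ul 0).
have bl : (b < l)%O := ul 0.
apply: (eq_of_common_values_nearby _ _ l hX (cg i Di l) (ch i Di l)) => U.
move=> /(nbhs_omega1_left b l U bl)[a al aU].
have [n aun] : exists n, (a <= u n)%O.
  apply: contrapT => na; suff /lmin : forall n, (u n < a)%O by rewrite leNgt al.
  by move=> n; rewrite ltNge; apply/negP => aun; apply: na; exists n.
have [_ /(_ i Di)[x [y [/andP[ux xu] /andP[uy yu] e]]]] := sP (u n).
by exists x, y; split => //; apply: aU;
  [exact: le_lt_trans ux | exact: lt_trans (ul n.+1)
  |exact: le_lt_trans uy | exact: lt_trans (ul n.+1)].
Qed.

(** If [f] avoids cofinal agreement with [iota], then on a tail it takes values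
    in the countable set [C] consisting of the complement of the range of [iota]
    and of an initial segment of that range. Values taken only boundedly often
    are excluded by passing to a further tail, and all the remaining values are
    equal, because they are attained at a common limit. *)
Lemma cofinal_agreement_or_eventually_constant {X : topologicalType}
    (iota f : omega1 -> X) : hausdorff_space X -> cocountable (range iota) ->
  continuous f -> ~ cofinally_agree f iota ->
  exists b c, forall x, (b < x)%O -> f x = c.
Proof.
move=> hX cA cf /existsNP[g gP].
have [_ _ seg] := omega1_is_first_uncountable.
pose C := ~` range iota `|` iota @` ([set y | (y < g)%O] `|` [set g]).
have cC : countable C.
  apply: countable_setU => //; apply: countable_image.
  by apply: countable_setU; [exact: seg | exact: countable1].
have fC x : (g < x)%O -> C (f x).
  move=> gx; have [[y _ yfx]|] := pselect (range iota (f x)); last by left.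
  right; exists y => //; have [yg|gy|->] := ltgtP y g; [by left| |by right].
  by exfalso; apply: gP; exists x, y; split.
(* [B c] bounds the arguments where the value [c] is taken, if they are bounded. *)
pose often c := forall b, exists2 x, (b < x)%O & f x = c.
have /choice[B BP] c : exists b, ~ often c -> forall x, (b < x)%O -> f x <> c.
  have [?|/existsNP[b bP]] := pselect (often c); first by exists g.
  by exists b => _ x bx fx; apply: bP; exists x.
have [|b bP] := @countable_bounded ([set g] `|` B @` C).
  by apply: countable_setU; [exact: countable1 | exact: countable_image].
have fE x : (b < x)%O -> C (f x) /\ often (f x).
  move=> bx; have gx : (g < x)%O by apply: lt_trans bx; apply: bP; left.
  split; first exact: fC.
  apply: contrapT => /BP/(_ x); apply => //; apply: lt_trans bx.
  by apply: bP; right; exists (f x) => //; exact: fC.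
have [|||l bl lP] := cofinal_agreement_at_limit
    (C `&` often) (fun=> f) (fun c _ => c) hX _ (fun _ _ => cf) _ _ b.
- exact: sub_countable (subset_card_le (@subIsetl _ _ _)) cC.
- by move=> c _ x; exact: cst_continuous.
(* Each remaining value [c] is a constant map that [f] meets cofinally. *)
- by move=> c [_ oc] a; have [x ax <-] := oc a; exists x, x.
by exists b, (f l) => x /fE bx; rewrite (lP _ bx).
Qed.

Theorem corollary1 (X : topologicalType) (X_separable : separable X)
    (X_hausdorff : hausdorff_space X)
    (X_omega1 : exists A : set X, cocountable A /\ homeomorphic A omega1) :
  ~ exists mu : X -> X -> X, is_mean mu /\ separately_continuous mu.
Proof.
case=> mu [[mu_idem mu_comm] mu_cont].
have [A [cA [f [k [cf ck fK kK]]]]] := X_omega1.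
have [D cD dD] := X_separable.
pose iota (x : omega1) : X := set_val (k x).
have iota_cont : continuous iota.
  move=> x; apply: (@continuous_comp _ _ _ k set_val); first exact: ck.
  exact: initial_continuous.
have iota_inj : injective iota by move=> x y /val_inj /(can_inj kK).
have iota_cocountable : cocountable (range iota).
  apply: sub_countable cA; apply: subset_card_le; apply: subsetC => a Aa.
  by exists (f (SigSub (mem_set Aa))) => //; rewrite /iota fK.
have mu_iota_cont d : continuous (fun x => mu d (iota x)).
  move=> x; apply: (@continuous_comp _ _ _ iota (mu d)); first exact: iota_cont.
  by have [+ _] := mu_cont d; apply.
pose D2 := D `&` [set d | cofinally_agree (fun x => mu d (iota x)) iota].
pose D1 := D `&` [set d | ~ cofinally_agree (fun x => mu d (iota x)) iota].
have D12 : D = D1 `|` D2.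
  apply/seteqP; split=> [d Dd|d [[]|[]] //].
  by have [?|?] := pselect (cofinally_agree (fun x => mu d (iota x)) iota);
    [right|left].
have cD1 : countable D1 by exact: sub_countable (subset_card_le (@subIsetl _ _ _)) cD.
have cD2 : countable D2 by exact: sub_countable (subset_card_le (@subIsetl _ _ _)) cD.
have [o _] := countable_bounded set0 (countable0 _).
have /choice[B BP] d : exists b, D1 d ->
    forall x y, (b < x)%O -> (b < y)%O -> mu d (iota x) = mu d (iota y).
  have [D1d|nD1d] := pselect (D1 d); last by exists o.
  have [b [c bc]] := cofinal_agreement_or_eventually_constant iota _ X_hausdorff
    iota_cocountable (mu_iota_cont d) D1d.2.
  by exists b => _ x y bx by_; rewrite !bc.
have [b bP] := countable_bounded _ (countable_image B D1 cD1).
pose good x := (b < x)%O /\ forall d, D2 d -> mu d (iota x) = iota x.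
have next a : (b <= a)%O -> exists2 x, (a < x)%O & good x.
  move=> ba; have [|||x ax xP] := cofinal_agreement_at_limit D2
    (fun d x => mu d (iota x)) (fun=> iota) X_hausdorff cD2 _ _ _ a.
  - by [].
  - by [].
  - by move=> d [].
  by exists x => //; split=> //; exact: le_lt_trans ax.
have close1 x y : good x -> good y ->
    closure D1 (iota x) -> closure D1 (iota y) -> iota x = iota y.
  move=> [bx _] [by_ _] Dx Dy.
  have tail z : closure D1 z -> mu z (iota x) = mu z (iota y).
    apply: (eq_on_closure (mu^~ (iota x)) (mu^~ (iota y)) D1 X_hausdorff
      (mu_cont _).2 (mu_cont _).2) => d D1d.
    have Bb : (B d < b)%O by apply: bP; exists d.
    by apply: (BP d D1d); apply: lt_trans Bb _.
  by rewrite -[LHS]mu_idem tail // mu_comm tail // mu_idem.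
have close2 x y : good x -> good y ->
    closure D2 (iota x) -> closure D2 (iota y) -> iota x = iota y.
  move=> gx gy Dx Dy.
  have fixd t z : good t -> closure D2 z -> mu z (iota t) = iota t.
    move=> [_ tP]; apply: (eq_on_closure (mu^~ (iota t)) (cst (iota t)) D2
      X_hausdorff (mu_cont _).2) => //.
    by move=> w; exact: cst_continuous.
  by rewrite -(fixd x (iota y)) // mu_comm fixd.
have [x1 bx1 g1] := next b (lexx b).
have [x2 x12 g2] := next x1 (ltW g1.1).
have [x3 x23 g3] := next x2 (ltW g2.1).
have cover x : closure D1 (iota x) \/ closure D2 (iota x).
  have := closure_dense D (iota x) dD.
  by rewrite D12 closureU.
have x13 := lt_trans x12 x23.
have [neq12 neq13 neq23] : [/\ iota x1 <> iota x2, iota x1 <> iota x3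
    & iota x2 <> iota x3].
  by split=> /iota_inj /eqP; rewrite lt_eqF.
by case: (cover x1) (cover x2) (cover x3) => C1 [] C2 [] C3;
  solve [exact: neq12 (close1 _ _ g1 g2 C1 C2) | exact: neq12 (close2 _ _ g1 g2 C1 C2)
       | exact: neq13 (close1 _ _ g1 g3 C1 C3) | exact: neq13 (close2 _ _ g1 g3 C1 C3)
       | exact: neq23 (close1 _ _ g2 g3 C2 C3) | exact: neq23 (close2 _ _ g2 g3 C2 C3)].
Qed.
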